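(* Let $n_d,n_a,n_f,u_{\max}\ge1$ be integers, let $U=\{-u_{\max},\dots,0,\dots,u_{\max}\}\subset\mathbb Z$, and let $$\mathcal U=\prod_{i=0}^{n_d-1}U_{x,i}\times U_{y,i},\qquad U_{x,i}=U_{y,i}=U\ \text{ for all } i,$$ with elements $\mathrm u^d=(u^d_0,\dots,u^d_{n_d-1})$, $u^d_i=(u^d_{x,i},u^d_{y,i})$. Fix the current defender locations $z^d_i=(x^d_i,y^d_i)\in\mathbb Z^2$ ($0\le i\le n_d-1$), the predicted next attacker locations $(z^a_g)^+\in\mathbb Z^2$ ($0\le g\le n_a-1$), the defense zone points $z^f_h\in\mathbb Z^2$ ($0\le h\le n_f-1$), and the obstacle locations. For $\mathrm u^d\in\mathcal U$ put $(z^d_i)^+=z^d_i+u^d_i$ and define $J(\mathrm u^d)=\sum_{i=0}^{n_d-1}J_i(\mathrm u^d)$, where $$J_i=\alpha_i^fJ_i^f+\alpha_i^aJ_i^a+J_i^d+J_i^{\mathrm{avoid}}+J_i^{\mathrm{mob}},$$ $$J_i^f=\sum_{h=0}^{n_f-1}w^f_{ih}\,d\bigl((z_i^d)^+,z_h^f\bigr),\qquad J_i^a=\sum_{g=0}^{n_a-1}w^a_{ig}\,d\bigl((z_i^d)^+,(z_g^a)^+\bigr),\qquad J_i^d=\sum_{j=0}^{n_d-1}w^d_{ij}\,d\bigl((z_i^d)^+,(z_j^d)^+\bigr),$$ $$J_i^{\mathrm{avoid}}=\sum_{c_x\in X^d_{i,\mathrm{avoid}}}d_{x,\mathrm{avoid}}\bigl((z_i^d)^+,c_x\bigr)+\sum_{c_y\in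 Y^d_{i,\mathrm{avoid}}}d_{y,\mathrm{avoid}}\bigl((z_i^d)^+,c_y\bigr),\qquad J_i^{\mathrm{mob}}=w^u_i\bigl(|u^d_{x,i}|^2+|u^d_{y,i}|^2\bigr).$$ Here $d$ is either of the two functions $$d(z_i,z_j)=(x_i-x_j)^2+(y_i-y_j)^2\quad\text{or}\quad d(z_i,z_j)=|x_i-x_j|+|y_i-y_j|\qquad(z_i=(x_i,y_i),\ z_j=(x_j,y_j)),$$ and, for $z=(x,y)$, $$d_{x,\mathrm{avoid}}(z,c_x)=\zeta_1e^{-\zeta_2(x-c_x)^2},\qquad d_{y,\mathrm{avoid}}(z,c_y)=\zeta_1e^{-\zeta_2(y-c_y)^2},\qquad \zeta_1\ge1,\ \zeta_2\ge1.$$ Then the problem $$\min_{\mathrm u^d\in\mathcal U}J(\mathrm u^d)\quad\text{subject to}\quad (\mathrm z^d)^+=\mathrm z^d+\mathrm u^d$$ is a submodular minimization problem over $\mathcal U$, i.e. $\mathrm u^d\mapsto J(\mathrm u^d)$ is a submodular function on $\mathcal U$.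
   Context: $\mathcal U$ is regarded as a product of $2n_d$ chains (each a copy of $U$ with the usual order) with the componentwise order; $\vee$ and $\wedge$ are the componentwise maximum and minimum. A function $f:\mathcal U\to\mathbb R$ is submodular if $f(\mathrm u\vee\mathrm v)+f(\mathrm u\wedge\mathrm v)\le f(\mathrm u)+f(\mathrm v)$ for all $\mathrm u,\mathrm v\in\mathcal U$. Setting: a team of $n_d$ defenders on an integer grid moves in one time step from $z^d_i$ to $(z^d_i)^+=z^d_i+u^d_i$, and chooses $\mathrm u^d$ at the current time by solving the stated problem. The vector $\mathrm z^d$ stacks the $z^d_i$. The weights $w^f_{ih},w^a_{ig},w^d_{ij},w^u_i$ are non-negative reals, and $\alpha_i^a,\alpha_i^f\ge0$ satisfy $\alpha_i^a+\alpha_i^f=1$; none of these depend on $\mathrm u^d$. The sets $X^d_{i,\mathrm{avoid}},Y^d_{i,\mathrm{avoid}}\subset\mathbb Z$ are finite (possibly empty) sets of $x$-coordinates, respectively $y$-coordinates, called collision avoidance planes. They are determined by the current defender locations and the obstacle locations and do not depend on $\mathrm u^d$. They are chosen so that if $(x_i^d)^+\notin X^d_{i,\mathrm{avoid}}$ and $(y_i^d)^+\notin Y^d_{i,\mathrm{avoid}}$, then defender $i$'s next location lies outside the set of those points of its one-step reachable set that either belong to the one-step reachable set of another defender or are obstacle locations. *)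

(* Defs.v *)
From HB Require Import structures.
From mathcomp Require Import all_boot all_order all_algebra finmap.
From mathcomp Require Import boolp classical_sets reals sequences exp.
Set Implicit Arguments.
Unset Strict Implicit.
Unset Printing Implicit Defensive.
Import Order.TTheory GRing.Theory Num.Theory.
Local Open Scope classical_set_scope.
Local Open Scope ring_scope.

Definition submodular (R : realType) (disp : Order.disp_t)
    (L : latticeType disp) (f : L -> R) : Prop :=
  forall u v : L, f (u `|` v)%O + f (u `&` v)%O <= f u + f v.

(* The chain U = {-umax, ..., umax}, ordered as a subtype of int. *)
Record step (umax : nat) := Step {
  step_val :> int;
  stepP : - umax%:Z <= step_val <= umax%:Z }.

HB.instance Definition _ (umax : nat) := [isSub for @step_val umax].
HB.instance Definition _ (umax : nat) := [Choice of step umax by <:].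
HB.instance Definition _ (umax : nat) :=
  [SubChoice_isSubOrder of step umax by <: with ring_display].

(* A single control (u_x, u_y) in U x U, with the product order. *)
Notation control umax := (step umax *p step umax)%type.

(* The product of 2 nd chains; its lattice structure is the pointwise one on
   functions, so join and meet are componentwise maximum and minimum: see
   joint_joinE and joint_meetE. *)
Notation joint_control nd umax := ('I_nd -> control umax).

Lemma step_joinE (umax : nat) (a b : step umax) :
  (a `|` b)%O = Num.max (a : int) b :> int.
Proof. by rewrite joinEtotal !maxEle -Order.le_val; case: ifP. Qed.

Lemma step_meetE (umax : nat) (a b : step umax) :
  (a `&` b)%O = Num.min (a : int) b :> int.
Proof. by rewrite meetEtotal !minEle -Order.le_val; case: ifP. Qed.

Lemma joint_joinE (nd umax : nat) (u v : joint_control nd umax) (i : 'I_nd) :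
  ((u `|` v)%O i).1 = Num.max ((u i).1 : int) (v i).1 :> int /\
  ((u `|` v)%O i).2 = Num.max ((u i).2 : int) (v i).2 :> int.
Proof. by split; rewrite -step_joinE. Qed.

Lemma joint_meetE (nd umax : nat) (u v : joint_control nd umax) (i : 'I_nd) :
  ((u `&` v)%O i).1 = Num.min ((u i).1 : int) (v i).1 :> int /\
  ((u `&` v)%O i).2 = Num.min ((u i).2 : int) (v i).2 :> int.
Proof. by split; rewrite -step_meetE. Qed.

Definition gridpt : Type := int * int.

Definition next_loc (umax : nat) (z : gridpt) (u : control umax) : gridpt :=
  (z.1 + u.1, z.2 + u.2).

Definition next_locs (nd umax : nat) (zd : 'I_nd -> gridpt)
    (u : joint_control nd umax) : 'I_nd -> gridpt :=
  fun i => next_loc (zd i) (u i).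

Definition sq_dist (R : realType) (z z' : gridpt) : R :=
  ((z.1 - z'.1) ^+ 2 + (z.2 - z'.2) ^+ 2)%:~R.

Definition l1_dist (R : realType) (z z' : gridpt) : R :=
  (`|z.1 - z'.1| + `|z.2 - z'.2|)%:~R.

Definition reachable (umax : nat) (z : gridpt) : set gridpt :=
  [set next_loc z u | u in [set: control umax]].

Definition conflict_set (nd umax : nat) (zd : 'I_nd -> gridpt)
    (obstacles : set gridpt) (i : 'I_nd) : set gridpt :=
  reachable umax (zd i) `&`
  ((\bigcup_(j in [set j | j != i]) reachable umax (zd j)) `|` obstacles).

Definition avoidance_planes (nd umax : nat) (zd : 'I_nd -> gridpt)
    (obstacles : set gridpt) (Xavoid Yavoid : 'I_nd -> {fset int}) : Prop :=
  forall (i : 'I_nd) (u : control umax),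
    (next_loc (zd i) u).1 \notin Xavoid i ->
    (next_loc (zd i) u).2 \notin Yavoid i ->
    ~ conflict_set umax zd obstacles i (next_loc (zd i) u).

Definition d_x_avoid (R : realType) (zeta1 zeta2 : R) (z : gridpt) (c : int) : R :=
  zeta1 * expR (- zeta2 * (z.1 - c)%:~R ^+ 2).

Definition d_y_avoid (R : realType) (zeta1 zeta2 : R) (z : gridpt) (c : int) : R :=
  zeta1 * expR (- zeta2 * (z.2 - c)%:~R ^+ 2).

(* In the costs below, zn gives the next defender locations and za the
   predicted next attacker locations. *)
Definition J_f (R : realType) (nd nf : nat) (d : gridpt -> gridpt -> R)
    (wf : 'I_nd -> 'I_nf -> R) (zf : 'I_nf -> gridpt)
    (zn : 'I_nd -> gridpt) (i : 'I_nd) : R :=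
  \sum_(h < nf) wf i h * d (zn i) (zf h).

Definition J_a (R : realType) (nd na : nat) (d : gridpt -> gridpt -> R)
    (wa : 'I_nd -> 'I_na -> R) (za : 'I_na -> gridpt)
    (zn : 'I_nd -> gridpt) (i : 'I_nd) : R :=
  \sum_(g < na) wa i g * d (zn i) (za g).

Definition J_d (R : realType) (nd : nat) (d : gridpt -> gridpt -> R)
    (wd : 'I_nd -> 'I_nd -> R) (zn : 'I_nd -> gridpt) (i : 'I_nd) : R :=
  \sum_(j < nd) wd i j * d (zn i) (zn j).

Definition J_avoid (R : realType) (nd : nat) (zeta1 zeta2 : R)
    (Xavoid Yavoid : 'I_nd -> {fset int})
    (zn : 'I_nd -> gridpt) (i : 'I_nd) : R :=
  \sum_(c <- Xavoid i) d_x_avoid zeta1 zeta2 (zn i) c +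
  \sum_(c <- Yavoid i) d_y_avoid zeta1 zeta2 (zn i) c.

Definition J_mob (R : realType) (nd umax : nat) (wu : 'I_nd -> R)
    (u : joint_control nd umax) (i : 'I_nd) : R :=
  wu i * (`|(u i).1 : int|%:~R ^+ 2 + `|(u i).2 : int|%:~R ^+ 2).

Definition J (R : realType) (nd na nf umax : nat)
    (zd : 'I_nd -> gridpt) (za : 'I_na -> gridpt) (zf : 'I_nf -> gridpt)
    (d : gridpt -> gridpt -> R) (alpha_f alpha_a : 'I_nd -> R)
    (wf : 'I_nd -> 'I_nf -> R) (wa : 'I_nd -> 'I_na -> R)
    (wd : 'I_nd -> 'I_nd -> R) (wu : 'I_nd -> R)
    (zeta1 zeta2 : R) (Xavoid Yavoid : 'I_nd -> {fset int})
    (u : joint_control nd umax) : R :=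
  let zn := next_locs zd u in
  \sum_(i < nd)
    (alpha_f i * J_f d wf zf zn i + alpha_a i * J_a d wa za zn i +
     J_d d wd zn i + J_avoid zeta1 zeta2 Xavoid Yavoid zn i + J_mob wu u i).

(* Main.v *)
(* Sums and non-negative multiples of submodular functions are submodular. A
   function of a single coordinate is modular, because a coordinate ranges over
   a chain; this covers the avoidance and mobility terms, without any convexity.
   A convex function of the difference of two coordinates is submodular; this
   covers the distances, a fixed target being a constant coordinate. *)

Require Import Defs.
From HB Require Import structures.
From mathcomp Require Import all_boot all_order all_algebra finmap.
From mathcomp Require Import zify.
From mathcomp Require Import boolp classical_sets reals sequences exp.
Set Implicit Arguments.
Unset Strict Implicit.
Unset Printing Implicit Defensive.
Import Order.TTheory GRing.Theory Num.Theory.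
Local Open Scope ring_scope.

Section SubmodularClosure.
Variables (R : realType) (disp : Order.disp_t) (L : latticeType disp).
Implicit Types f g : L -> R.

Lemma submodularD f g :
  submodular f -> submodular g -> submodular (fun u => f u + g u).
Proof. by move=> sf sg u v; rewrite addrACA [leRHS]addrACA lerD. Qed.

Lemma submodularZ (a : R) f :
  0 <= a -> submodular f -> submodular (fun u => a * f u).
Proof. by move=> a0 sf u v; rewrite -!mulrDr ler_wpM2l. Qed.

Lemma submodular_sum (I : Type) (r : seq I) (F : I -> L -> R) :
  (forall i, submodular (F i)) -> submodular (fun u => \sum_(i <- r) F i u).
Proof.
move=> sF u v; rewrite -!big_split /=.
by apply: ler_sum => i _; apply: sF.
Qed.

End SubmodularClosure.

(** Abstracts the word coordinate: components of the control, next locations and fixed targets all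
    become such maps into a chain, so the submodularity lemmas can be stated over an arbitrary
    lattice. *)
Definition lattice_morph (disp disp' : Order.disp_t) (L : latticeType disp)
    (M : latticeType disp') (h : L -> M) : Prop :=
  {morph h : u v / (u `|` v)%O} /\ {morph h : u v / (u `&` v)%O}.

(** Convexity on the integers as monotone increments, with two independent steps: the four-point
    form that submodularity of a difference calls for. *)
Definition discrete_convex (phi : int -> int) : Prop :=
  forall x p q : int, 0 <= p -> 0 <= q ->
    phi (x + p) + phi (x + q) <= phi x + phi (x + p + q).

(** The right side exceeds the left by [2 * p * q]. *)
Lemma discrete_convex_sqr : discrete_convex (fun x => x ^+ 2).
Proof. by move=> x p q p0 q0; rewrite !expr2; nia. Qed.

Lemma discrete_convex_norm : discrete_convex (fun x => `|x|).
Proof. by move=> x p q p0 q0; lia. Qed.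

Section ChainMorphisms.
Variables (R : realType) (disp : Order.disp_t) (L : latticeType disp).

Lemma lattice_morph_cst (disp' : Order.disp_t) (M : latticeType disp') (c : M) :
  lattice_morph (fun _ : L => c).
Proof. by split=> u v; rewrite ?joinxx ?meetxx. Qed.

Lemma lattice_morph_shift (h : L -> int) (c : int) :
  lattice_morph h -> lattice_morph (fun u => c + h u).
Proof.
move=> [hU hI]; split=> u v; rewrite ?hU ?hI !(joinEtotal, meetEtotal).
  by rewrite addr_maxr.
by rewrite addr_minr.
Qed.

(** In a chain, the join and meet of [h u] and [h v] are these same two values, possibly exchanged,
    so equality holds for every [phi]. *)
Lemma submodular_chain (disp' : Order.disp_t) (T : orderType disp')
    (h : L -> T) (phi : T -> R) :
  lattice_morph h -> submodular (fun u => phi (h u)).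
Proof.
move=> [hU hI] u v; rewrite hU hI.
by have [//|_] := leP (h u) (h v); rewrite addrC.
Qed.

Lemma submodular_convex_diff (phi : int -> int) (h k : L -> int) :
  discrete_convex phi -> lattice_morph h -> lattice_morph k ->
  submodular (fun u => (phi (h u - k u))%:~R : R).
Proof.
move=> cphi [hU hI] [kU kI] u v; rewrite hU hI kU kI -!intrD ler_int.
(* Here [a - c] is the smallest of the four differences and [b - e] the largest, with the same sum
   as the two middle ones. Convexity applies at [a - c] with steps [b - a] and [c - e]. *)
have crossed (a b c e : int) : a <= b -> e <= c ->
    phi (b - c) + phi (a - e) <= phi (a - c) + phi (b - e).
  move=> ab ec; have := cphi (a - c) (b - a) (c - e).
  rewrite !subr_ge0 => /(_ ab ec).
  have -> : a - c + (b - a) = b - c by lia.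
  have -> : a - c + (c - e) = a - e by lia.
  by have -> : b - c + (c - e) = b - e by lia.
(* If [h] and [k] order [u] and [v] alike, both sides have the same terms; if they disagree, join
   and meet produce the middle differences of [crossed]. *)
have [huv|/ltW hvu] := leP (h u) (h v); have [kuv|/ltW kvu] := leP (k u) (k v).
- by rewrite addrC.
- exact: crossed.
- by rewrite [leRHS]addrC; apply: crossed.
- by [].
Qed.

Lemma submodular_sq_dist (z z' : L -> gridpt) :
  lattice_morph (fun u => (z u).1) -> lattice_morph (fun u => (z u).2) ->
  lattice_morph (fun u => (z' u).1) -> lattice_morph (fun u => (z' u).2) ->
  submodular (fun u => sq_dist R (z u) (z' u)).
Proof.
move=> z1 z2 z'1 z'2 u v; rewrite /sq_dist !intrD.
by apply: (submodularD (submodular_convex_diff discrete_convex_sqr z1 z'1)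
                       (submodular_convex_diff discrete_convex_sqr z2 z'2)).
Qed.

Lemma submodular_l1_dist (z z' : L -> gridpt) :
  lattice_morph (fun u => (z u).1) -> lattice_morph (fun u => (z u).2) ->
  lattice_morph (fun u => (z' u).1) -> lattice_morph (fun u => (z' u).2) ->
  submodular (fun u => l1_dist R (z u) (z' u)).
Proof.
move=> z1 z2 z'1 z'2 u v; rewrite /l1_dist !intrD.
by apply: (submodularD (submodular_convex_diff discrete_convex_norm z1 z'1)
                       (submodular_convex_diff discrete_convex_norm z2 z'2)).
Qed.

End ChainMorphisms.

Section Controls.
Variables (nd umax : nat).

Lemma lattice_morph_control1 (i : 'I_nd) :
  lattice_morph (fun u : joint_control nd umax => (u i).1 : int).
Proof.
split=> u v; rewrite (joinEtotal, meetEtotal).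
  by have [] := joint_joinE u v i.
by have [] := joint_meetE u v i.
Qed.

Lemma lattice_morph_control2 (i : 'I_nd) :
  lattice_morph (fun u : joint_control nd umax => (u i).2 : int).
Proof.
split=> u v; rewrite (joinEtotal, meetEtotal).
  by have [] := joint_joinE u v i.
by have [] := joint_meetE u v i.
Qed.

Lemma lattice_morph_next1 (zd : 'I_nd -> gridpt) (i : 'I_nd) :
  lattice_morph (fun u : joint_control nd umax => (next_locs zd u i).1).
Proof. exact: lattice_morph_shift (lattice_morph_control1 i). Qed.

Lemma lattice_morph_next2 (zd : 'I_nd -> gridpt) (i : 'I_nd) :
  lattice_morph (fun u : joint_control nd umax => (next_locs zd u i).2).
Proof. exact: lattice_morph_shift (lattice_morph_control2 i). Qed.

End Controls.

Theorem theoremV1 (R : realType) (nd na nf umax : nat)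
    (nd_ge1 : (1 <= nd)%N) (na_ge1 : (1 <= na)%N) (nf_ge1 : (1 <= nf)%N)
    (umax_ge1 : (1 <= umax)%N)
    (zd : 'I_nd -> gridpt) (za : 'I_na -> gridpt) (zf : 'I_nf -> gridpt)
    (obstacles : set gridpt)
    (d : gridpt -> gridpt -> R)
    (d_cases : d = @sq_dist R \/ d = @l1_dist R)
    (alpha_f alpha_a : 'I_nd -> R)
    (alpha_f_ge0 : forall i, 0 <= alpha_f i)
    (alpha_a_ge0 : forall i, 0 <= alpha_a i)
    (alpha_sum : forall i, alpha_a i + alpha_f i = 1)
    (wf : 'I_nd -> 'I_nf -> R) (wa : 'I_nd -> 'I_na -> R)
    (wd : 'I_nd -> 'I_nd -> R) (wu : 'I_nd -> R)
    (wf_ge0 : forall i h, 0 <= wf i h) (wa_ge0 : forall i g, 0 <= wa i g)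
    (wd_ge0 : forall i j, 0 <= wd i j) (wu_ge0 : forall i, 0 <= wu i)
    (zeta1 zeta2 : R) (zeta1_ge1 : 1 <= zeta1) (zeta2_ge1 : 1 <= zeta2)
    (Xavoid Yavoid : 'I_nd -> {fset int})
    (planes : avoidance_planes umax zd obstacles Xavoid Yavoid) :
  submodular (fun u : joint_control nd umax =>
    J zd za zf d alpha_f alpha_a wf wa wd wu zeta1 zeta2 Xavoid Yavoid u).
Proof.
(* From here on, the two choices of [d] are treated uniformly. *)
have sd (z z' : joint_control nd umax -> gridpt) :
    lattice_morph (fun u => (z u).1) -> lattice_morph (fun u => (z u).2) ->
    lattice_morph (fun u => (z' u).1) -> lattice_morph (fun u => (z' u).2) ->
    submodular (fun u => d (z u) (z' u)).
  by case: d_cases => ->; [apply: submodular_sq_dist | apply: submodular_l1_dist].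
have m1 := @lattice_morph_next1 nd umax zd.
have m2 := @lattice_morph_next2 nd umax zd.
apply: submodular_sum => i.
apply: submodularD; first apply: submodularD; first apply: submodularD;
  first apply: submodularD.
- apply: submodularZ => //; apply: submodular_sum => h; apply: submodularZ => //.
  by apply: sd => //; apply: lattice_morph_cst.
- apply: submodularZ => //; apply: submodular_sum => g; apply: submodularZ => //.
  by apply: sd => //; apply: lattice_morph_cst.
(* Both points move with [u]; [sd] does not ask them to be distinct, so [j = i] is no special
   case. *)
- by apply: submodular_sum => j; apply: submodularZ => //; apply: sd.
(* For a fixed plane [c], each summand is a function of one coordinate of the next location. *)
- apply: submodularD; apply: submodular_sum => c.
    exact: (submodular_chain
      (fun x => zeta1 * expR (- zeta2 * (x - c)%:~R ^+ 2)) (m1 i)).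
  exact: (submodular_chain
    (fun y => zeta1 * expR (- zeta2 * (y - c)%:~R ^+ 2)) (m2 i)).
- apply: submodularZ => //; apply: submodularD.
    exact: (submodular_chain (fun x : int => `|x|%:~R ^+ 2)
      (@lattice_morph_control1 nd umax i)).
  exact: (submodular_chain (fun y : int => `|y|%:~R ^+ 2)
    (@lattice_morph_control2 nd umax i)).
Qed.
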